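(* Let $\mathfrak{H}$ be a fat indecomposable Hoffman graph with $\lambda_{\min}(\mathfrak{H})\ge -3$. Then every slim vertex of $\mathfrak{H}$ has at most three fat neighbors. Moreover, the following statements hold: (i) If some slim vertex has three fat neighbors, then $\mathfrak{H}\cong\mathfrak{H}^{(3)}$, where $\mathfrak{H}^{(3)}$ is the Hoffman graph with one slim vertex and three fat vertices, the slim vertex being adjacent to all three fat vertices. (ii) If no slim vertex has three fat neighbors and some slim vertex has exactly two fat neighbors, then $\Lambda^{\mathrm{red}}(\mathfrak{H},3)\simeq\mathbb{Z}^n$ (isometric to the standard lattice) for some positive integer $n$. (iii) If every slim vertex has a unique fat neighbor, then $\Lambda^{\mathrm{red}}(\mathfrak{H},3)$ is an irreducible root lattice.
   Context: Graphs are finite, non-empty, undirected, without loops or multiple edges. A Hoffman graph $\mathfrak{H}=(H,\mu)$ is a graph $H=(V,E)$ with a labeling $\mu:V\to\{f,s\}$ such that every vertex with label $f$ (a fat vertex) is adjacent to at least one vertex with label $s$ (a slim vertex), and fat vertices are pairwise non-adjacent. $V_s(\mathfrak{H})$, $V_f(\mathfrak{H})$ denote the sets of slim and fat vertices. $\mathfrak{H}$ is fat if every slim vertex has a fat neighbor. Isomorphisms of Hoffman graphs are graph isomorphisms preserving labels. Subgraph means induced subgraph with the restricted labeling that is a Hoffman graph. $N^f(x)$ is the set of fat neighbors of $x$, and $N^f(x,y)$ the set of common fat neighbors of $x$ and $y$. If the adjacency matrix is $\begin{pmatrix}A_s&C\\C^T&O\end{pmatrix}$ with fat vertices last, the eigenvalues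 of $\mathfrak{H}$ are those of $B(\mathfrak{H})=A_s-CC^T$; $\lambda_{\min}(\mathfrak{H})$ is the smallest one. A reduced representation of norm $m$ of $\mathfrak{H}$ is a map $\psi:V_s(\mathfrak{H})\to\mathbb{R}^n$ (for some $n$) with $(\psi(x),\psi(y))$ equal to $m-|N^f(x)|$ if $x=y$, to $1-|N^f(x,y)|$ if $x\ne y$ are adjacent, and to $-|N^f(x,y)|$ otherwise. It exists if and only if $\lambda_{\min}(\mathfrak{H})\ge -m$. $\Lambda^{\mathrm{red}}(\mathfrak{H},m)$ is the lattice generated by $\{\psi(x)\mid x\in V_s(\mathfrak{H})\}$; up to isometry it does not depend on $\psi$. $\mathfrak{H}$ is the sum $\mathfrak{H}^1\uplus\mathfrak{H}^2$ of two non-empty induced Hoffman subgraphs if: $V(\mathfrak{H})=V(\mathfrak{H}^1)\cup V(\mathfrak{H}^2)$; $\{V_s(\mathfrak{H}^1),V_s(\mathfrak{H}^2)\}$ is a partition of $V_s(\mathfrak{H})$; if $x\in V_s(\mathfrak{H}^i)$, $y\in V_f(\mathfrak{H})$ are adjacent then $y\in V_f(\mathfrak{H}^i)$; and any $x\in V_s(\mathfrak{H}^1)$, $y\in V_s(\mathfrak{H}^2)$ have at most one common fat neighbor, and they have one if and only if they are adjacent. $\mathfrak{H}$ is indecomposable if it is not such a sum. A root lattice is an integral lattice (in a Euclidean space) generated by vectors of squared length $2$; it is irreducible if it is not an orthogonal direct sum of two nonzero sublattices. *)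

(* Defs.v *)
From HB Require Import structures.
From mathcomp Require Import all_boot all_order all_algebra.
From mathcomp Require Import boolp classical_sets functions reals.

Set Implicit Arguments.
Unset Strict Implicit.
Unset Printing Implicit Defensive.

Import Order.TTheory GRing.Theory Num.Theory.
Local Open Scope ring_scope.

(* The labeling is the predicate [fat]; a vertex is slim when it is not fat. *)
Record hoffman := Hoffman {
  vertex :> finType;
  adj : rel vertex;
  fat : pred vertex;
  vertex_neq0 : (0 < #|vertex|)%N;
  adj_sym : symmetric adj;
  adj_irr : irreflexive adj;
  fat_has_slim : forall y, fat y -> exists x, ~~ fat x && adj y x;
  fat_nadj : forall y z, fat y -> fat z -> ~~ adj y z
}.

Arguments adj {h} _ _.
Arguments fat {h} _.

Definition slim_vertex (H : hoffman) : finType := {x : H | ~~ fat x}.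
Definition fat_vertex (H : hoffman) : finType := {x : H | fat x}.

Definition Vs (H : hoffman) : {set H} := [set x | ~~ fat x].

Definition Nf (H : hoffman) (x : H) : {set H} := [set y | fat y && adj x y].
Definition Nf2 (H : hoffman) (x y : H) : {set H} := Nf x :&: Nf y.

Definition fat_hoffman (H : hoffman) : Prop :=
  forall x : H, ~~ fat x -> exists y, fat y && adj x y.

Definition hoffman_iso (H K : hoffman) : Prop :=
  exists f : H -> K, [/\ bijective f,
    forall x y, adj (f x) (f y) = adj x y &
    forall x, fat (f x) = fat x].

Section HoffmanStar.
Variable t : nat.
Let V : finType := option 'I_t.

Definition star_adj : rel V := fun x y => isSome x != isSome y.
Definition star_fat : pred V := fun x => isSome x.

Lemma star_neq0 : (0 < #|V|)%N.
Proof. by apply/card_gt0P; exists None. Qed.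

Lemma star_sym : symmetric star_adj.
Proof. by move=> x y; rewrite /star_adj eq_sym. Qed.

Lemma star_irr : irreflexive star_adj.
Proof. by move=> x; rewrite /star_adj eqxx. Qed.

Lemma star_has_slim y : star_fat y -> exists x, ~~ star_fat x && star_adj y x.
Proof. by case: y => // i _; exists None. Qed.

Lemma star_nadj y z : star_fat y -> star_fat z -> ~~ star_adj y z.
Proof. by case: y => //; case: z. Qed.

(* H^(t): the slim vertex [None] joined to t fat vertices [Some i]. *)
Definition hoffman_star : hoffman :=
  Hoffman star_neq0 star_sym star_irr star_has_slim star_nadj.
End HoffmanStar.

(* S induces a Hoffman subgraph; the remaining conditions on a Hoffman graph
   are inherited by every induced subgraph. *)
Definition hoffman_sub (H : hoffman) (S : {set H}) : Prop :=
  S != finset.set0 /\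
  forall y, y \in S -> fat y -> exists2 x, x \in S & ~~ fat x && adj y x.

(* The slim vertices of V1 and V2 partition those of H: they cover them because
   V1 :|: V2 is everything, and both parts are nonempty because a Hoffman
   subgraph has a slim vertex. *)
Definition hoffman_sum (H : hoffman) (V1 V2 : {set H}) : Prop :=
  [/\ hoffman_sub V1, hoffman_sub V2 & V1 :|: V2 = [set: H]%SET] /\
  [/\ [disjoint V1 :&: Vs H & V2 :&: Vs H],
      forall W : {set H}, W = V1 \/ W = V2 ->
        forall x y, x \in W -> ~~ fat x -> fat y -> adj x y -> y \in W &
      forall x y, x \in V1 :&: Vs H -> y \in V2 :&: Vs H ->
        (#|Nf2 x y| <= 1)%N /\ (#|Nf2 x y| = 1%N <-> adj x y)].

Definition indecomposable (H : hoffman) : Prop :=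
  ~ exists V1 V2 : {set H}, hoffman_sum V1 V2.

Section Spectrum.
Variables (R : realType) (H : hoffman).

Definition adj_slim : 'M[R]_#|slim_vertex H| :=
  \matrix_(i, j) (adj (val (enum_val i)) (val (enum_val j)))%:R.

Definition adj_slim_fat : 'M[R]_(#|slim_vertex H|, #|fat_vertex H|) :=
  \matrix_(i, j) (adj (val (enum_val i)) (val (enum_val j)))%:R.

Definition Bmx : 'M[R]_#|slim_vertex H| :=
  adj_slim - adj_slim_fat *m adj_slim_fat^T.

(* [Bmx] is real symmetric and nonempty (a Hoffman graph has a slim vertex), so
   its set of eigenvalues is finite and nonempty, and the infimum is a
   minimum. *)
Definition lambda_min : R := inf [set a | eigenvalue Bmx a]%classic.
End Spectrum.

Section Lattice.
Local Open Scope classical_set_scope.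
Variable R : realType.

Definition dotp n (u v : 'rV[R]_n) : R := \sum_i u 0 i * v 0 i.

Definition subgroup n (L : set 'rV[R]_n) : Prop :=
  L 0 /\ forall u v, L u -> L v -> L (u - v).

(* A lattice is a discrete additive subgroup, not necessarily of full rank. *)
Definition is_lattice n (L : set 'rV[R]_n) : Prop :=
  subgroup L /\
  exists2 e : R, 0 < e & forall v, L v -> v != 0 -> e <= dotp v v.

Definition zspan n (S : set 'rV[R]_n) : set 'rV[R]_n :=
  [set v | exists k (u : 'I_k -> 'rV[R]_n) (c : 'I_k -> int),
     (forall i, S (u i)) /\ v = \sum_i u i *~ c i].

Definition integral n (L : set 'rV[R]_n) : Prop :=
  forall u v, L u -> L v -> dotp u v \is a Num.int.

Definition root_lattice n (L : set 'rV[R]_n) : Prop :=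
  [/\ is_lattice L, integral L & L = zspan [set v | L v /\ dotp v v = 2]].

Definition orthogonal_sum n (L L1 L2 : set 'rV[R]_n) : Prop :=
  [/\ forall u v, L1 u -> L2 v -> dotp u v = 0,
      L1 `&` L2 = [set 0] &
      L = [set w | exists u v, [/\ L1 u, L2 v & w = u + v]]].

Definition irreducible n (L : set 'rV[R]_n) : Prop :=
  ~ exists L1 L2 : set 'rV[R]_n,
      [/\ is_lattice L1, is_lattice L2, L1 <> [set 0], L2 <> [set 0] &
          orthogonal_sum L L1 L2].

(* Only the values of f on L matter. *)
Definition isometric m n (L : set 'rV[R]_m) (M : set 'rV[R]_n) : Prop :=
  exists f : 'rV[R]_m -> 'rV[R]_n,
    [/\ set_bij L M f,
        forall u v, L u -> L v -> f (u + v) = f u + f v &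
        forall u v, L u -> L v -> dotp (f u) (f v) = dotp u v].

Definition standard_lattice n : set 'rV[R]_n :=
  [set v | forall i, v 0 i \is a Num.int].

Definition reduced_representation (H : hoffman) (m : R) n
    (psi : slim_vertex H -> 'rV[R]_n) : Prop :=
  forall x y : slim_vertex H, dotp (psi x) (psi y) =
    if x == y then m - #|Nf (val x)|%:R
    else if adj (val x) (val y) then 1 - #|Nf2 (val x) (val y)|%:R
    else - #|Nf2 (val x) (val y)|%:R.

(* Lambda^red(H, m) is the lattice generated by a reduced representation of
   norm m; it is only determined up to isometry.  Saying that it has property P
   means that a reduced representation exists and that the lattice generated by
   any of them satisfies P. *)
Definition Lambda_red_has (H : hoffman) (m : R)
    (P : forall n, set 'rV[R]_n -> Prop) : Prop :=
  (exists n (psi : slim_vertex H -> 'rV[R]_n), reduced_representation m psi) /\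
  forall n (psi : slim_vertex H -> 'rV[R]_n),
    reduced_representation m psi -> P n (zspan (range psi)).
End Lattice.

Arguments standard_lattice : clear implicits.

(* Main.v *)
Require Import Defs.
From mathcomp Require Import all_boot all_order all_algebra.
From mathcomp Require Import boolp classical_sets functions reals.
From mathcomp Require Import complex polyrcf.
From mathcomp Require Import ring lra.

Import Order.TTheory GRing.Theory Num.Theory.
Local Open Scope ring_scope.

Set Implicit Arguments.
Unset Strict Implicit.
Unset Printing Implicit Defensive.

(* If the slim vertices split into two nonempty parts whose vectors in a reduced
   representation psi are mutually orthogonal, then the two parts, each with its
   fat neighbors, exhibit H as a sum.  So in an indecomposable H a property of
   slim vertices that holds once, and whose failure at y forces psi(y) to be
   orthogonal to all psi(x) with the property, holds everywhere.  Since H is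
   fat, |psi(x)|^2 = 3 - |N^f(x)| is 0, 1 or 2.
   (i) psi(x) = 0 is orthogonal to everything, so x is the only slim vertex.
   (ii) A vector of norm 2 not orthogonal to some unit vector e of the lattice is
   a sum of two unit vectors, one of which is e or -e; so by connectedness unit
   vectors generate the lattice, and unit vectors of an integral lattice are
   equal, opposite or orthogonal.
   (iii) The lattice is even, so in an orthogonal decomposition each psi(x), of
   norm 2, lies in one of the two summands; connectedness makes it the same one
   for all x. *)

(** * Bilinearity and positive definiteness of the dot product *)

Section DotProduct.
Variables (R : realType) (n : nat).
Implicit Types u v w : 'rV[R]_n.

Lemma dotpE u v : dotp u v = (u *m v^T) 0 0.
Proof. by rewrite mxE; apply: eq_bigr => i _; rewrite mxE. Qed.

Lemma dotpC u v : dotp u v = dotp v u.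
Proof. by apply: eq_bigr => i _; rewrite mulrC. Qed.

Lemma dotpBl u v w : dotp (u - v) w = dotp u w - dotp v w.
Proof. by rewrite !dotpE mulmxBl !mxE. Qed.

Lemma dotpBr u v w : dotp w (u - v) = dotp w u - dotp w v.
Proof. by rewrite dotpC dotpBl !(dotpC w). Qed.

Lemma dotp0l v : dotp 0 v = 0.
Proof. by rewrite dotpE mul0mx mxE. Qed.

Lemma dotpDl u v w : dotp (u + v) w = dotp u w + dotp v w.
Proof. by rewrite !dotpE mulmxDl !mxE. Qed.

Lemma dotpDr u v w : dotp w (u + v) = dotp w u + dotp w v.
Proof. by rewrite dotpC dotpDl !(dotpC w). Qed.

Lemma dotpNr u v : dotp u (- v) = - dotp u v.
Proof. by rewrite -sub0r dotpBr dotpC dotp0l sub0r. Qed.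

Lemma dotp_ge0 v : 0 <= dotp v v.
Proof. by apply: sumr_ge0 => i _; rewrite -expr2 sqr_ge0. Qed.

Lemma dotp_eq0 v : dotp v v = 0 -> v = 0.
Proof.
move=> /eqP; rewrite psumr_eq0 => [/allP v0|i _]; last by rewrite -expr2 sqr_ge0.
apply/rowP => i; rewrite mxE; apply/eqP.
by have := v0 i (mem_index_enum _); rewrite mulf_eq0 orbb.
Qed.

Lemma dotp_suml (I : Type) (r : seq I) (F : I -> 'rV[R]_n) v :
  dotp (\sum_(i <- r) F i) v = \sum_(i <- r) dotp (F i) v.
Proof.
rewrite dotpE mulmx_suml summxE; apply: eq_bigr => i _; by rewrite dotpE.
Qed.

Lemma dotpZl a u v : dotp (a *: u) v = a * dotp u v.
Proof. by rewrite !dotpE -scalemxAl mxE. Qed.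
End DotProduct.

(* Diagonalizing M = P^* diag(r) P over R[i] and taking real parts, M is the Gram
   matrix of the real vectors (sqrt r_i Re P_ix, sqrt r_i Im P_ix)_i. *)
Lemma psd_gram (R : rcfType) (n : nat) (M : 'M[R]_n) :
  M^T = M -> (forall a, eigenvalue M a -> 0 <= a) ->
  exists W : 'M[R]_(n, n + n), M = W *m W^T.
Proof.
move=> Msym Mge0; pose toC : {rmorphism R -> R[i]%C} := real_complex R.
pose MC := map_mx toC M.
have MCherm : MC \is hermsymmx.
  apply: realsym_hermsym.
    by apply/is_hermitianmxP; rewrite expr0 scale1r map_mx_id // map_trmx Msym.
  by apply/mxOverP => i j; rewrite mxE; apply/complex_realP; exists (M i j).
pose P := spectralmx MC; pose D := spectral_diag MC.
have PU : P \is unitarymx := spectral_unitarymx MC.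
have MCE : MC = invmx P *m diag_mx D *m P.
  by apply/orthomx_spectralP/hermitian_normalmx.
pose r i := complex.Re (D 0 i).
have Dr i : D 0 i = toC (r i).
  by apply/esym/RRe_real/mxOverP/hermitian_spectral_diag_real.
(* Row i of [P] is a left eigenvector of [MC] for [D 0 i], nonzero because [P] is unitary; as this
   eigenvalue is real, it is already an eigenvalue of [M]. *)
have r_ge0 i : 0 <= r i.
  apply: Mge0; rewrite -(eigenvalue_map toC) -Dr; apply/eigenvalueP.
  exists (row i P).
    rewrite -row_mul -/MC MCE !mulmxA mulmxV ?spectral_unit // mul1mx.
    by rewrite row_mul row_diag_mx -scalemxAl -rowE.
  apply/eqP => Pi0; have /unitarymxP/matrixP/(_ i i) := PU.
  rewrite [LHS]mxE [RHS]mxE eqxx big1 => [/esym/eqP|j _].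
    by rewrite oner_eq0.
  by have /rowP/(_ j) := Pi0; rewrite !mxE => ->; rewrite mul0r.
exists (row_mx (\matrix_(x, i) (Num.sqrt (r i) * complex.Re (P i x)))
               (\matrix_(x, i) (Num.sqrt (r i) * complex.Im (P i x)))).
apply/matrixP => x y; rewrite tr_row_mx mul_row_col !mxE -big_split /=.
have : toC (M x y) = MC x y by rewrite mxE.
rewrite MCE invmx_unitary // mxE => /(congr1 (@complex.Re R)) /= ->.
rewrite (raddf_sum (@complex.Re R)).
apply: eq_bigr => i _.
rewrite mul_mx_diag !mxE Dr /=.
case: (P i x) (P i y) => [a b] [c d].
rewrite /=; have /sqr_sqrtr := r_ge0 i.
by move: (Num.sqrt (r i)) => t <-; ring.
Qed.

(** * Existence of a reduced representation of norm 3 *)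

Section ReducedRepresentation.
Variables (R : realType) (H : hoffman).
Hypothesis H_min : - 3 <= lambda_min R H.

(** An infimum is a lower bound only once the set is known to be bounded below; the Cauchy bound on
    the roots of the characteristic polynomial provides this. *)
Lemma lambda_min_le a : eigenvalue (Bmx R H) a -> lambda_min R H <= a.
Proof.
move=> Ea; apply: ge_inf => //.
have p0 : char_poly (Bmx R H) != 0 by exact/monic_neq0/char_poly_monic.
exists (- cauchy_bound (char_poly (Bmx R H))) => b /= Eb.
have /(cauchy_boundP p0) : (char_poly (Bmx R H)).[b] = 0.
  by apply/rootP; rewrite -eigenvalue_root_char.
by rewrite ltr_norml => /andP[/ltW].
Qed.

Lemma Bmx_sym : (Bmx R H)^T = Bmx R H.
Proof.
rewrite /Bmx linearB /= trmx_mul trmxK; congr (_ - _).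
by apply/matrixP => i j; rewrite !mxE adj_sym.
Qed.

Lemma BmxE i j : let x := enum_val i in let y := enum_val j in
  Bmx R H i j = (adj (val x) (val y))%:R - #|Nf2 (val x) (val y)|%:R.
Proof.
rewrite !mxE; congr (_ - _).
set x := val _; set y := val _.
transitivity (\sum_(z : H | fat z) (adj x z && adj y z)%:R : R).
  rewrite (@big_sub _ _ _ _ fat).
  rewrite (reindex _ (onW_bij _ (@enum_val_bij (fat_vertex H)))).
  by apply: eq_bigr => z _; rewrite !mxE -natrM mulnb.
rewrite -sum1_card natr_sum big_mkcond [RHS]big_mkcond /=; apply: eq_bigr => z _.
by rewrite !inE; case: (fat z) (adj x z) (adj y z) => [] [] [].
Qed.

Lemma reduced_representation_ex : exists n (psi : slim_vertex H -> 'rV[R]_n),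
  reduced_representation 3 psi.
Proof.
(* The shift by 3 makes the spectrum nonnegative, and the Gram matrix required of [psi] is exactly
   the shifted one, so the rows of [W] serve. *)
have [||W BW] := @psd_gram R _ (Bmx R H + 3%:M).
- by rewrite linearD /= Bmx_sym tr_scalar_mx.
- move=> a /eigenvalueP[v va v0].
  suff /lambda_min_le /(le_trans H_min) : eigenvalue (Bmx R H) (a - 3) by lra.
  apply/eigenvalueP; exists v => //.
  by rewrite scalerBl -va (mulmxDr v _ 3%:M) mul_mx_scalar addrK.
exists (#|slim_vertex H| + #|slim_vertex H|)%N, (fun x => row (enum_rank x) W).
move=> x y.
have -> : dotp (row (enum_rank x) W) (row (enum_rank y) W) =
    (Bmx R H + 3%:M) (enum_rank x) (enum_rank y).
  rewrite BW !mxE; apply: eq_bigr => i _; by rewrite !mxE.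
rewrite mxE BmxE !enum_rankK mxE (inj_eq enum_rank_inj).
case: eqP => [->|_]; first by rewrite adj_irr sub0r addrC /Nf2 finset.setIid.
by case: adj; rewrite /= addr0 // sub0r.
Qed.
End ReducedRepresentation.

(** * Sums induced by a splitting of the slim vertices *)

Section Combinatorics.
Variable H : hoffman.

(** Fat neighbors are adjoined to the slim vertices in [P]; a fat vertex may thus lie in the
    closures of both [P] and its complement. *)
Definition slim_closure (P : pred H) : {set H} :=
  [set v | if fat v then [exists x, [&& ~~ fat x, P x & adj v x]] else P v]%SET.

Lemma slim_closure_sub (P : pred H) x :
  ~~ fat x -> P x -> hoffman_sub (slim_closure P).
Proof.
move=> sx Px; split.
  by apply/set0Pn; exists x; rewrite inE (negbTE sx).
move=> y; rewrite inE => + fy; rewrite fy => /existsP[z /and3P[sz Pz yz]].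
by exists z; rewrite ?inE (negbTE sz) //= yz.
Qed.

Lemma slim_closureU (P : pred H) :
  (slim_closure P :|: slim_closure (predC P))%SET = [set: H]%SET.
Proof.
apply/setP => v; rewrite !inE; case: ifP => [fv|_]; last by rewrite /= orbN.
have [x /andP[sx vx]] := fat_has_slim fv.
case: (boolP (P x)) => [Px|nPx]; apply/orP; [left|right];
  by apply/existsP; exists x; rewrite sx /= ?nPx ?Px.
Qed.

(** Otherwise the closures of [P] and of its complement form a sum. Equating the cardinal with a
    boolean read as 0 or 1 encodes both conditions on common fat neighbors. *)
Lemma indecomposable_slim_pred (P : pred H) x0 : indecomposable H ->
  ~~ fat x0 -> P x0 ->
  (forall x y, ~~ fat x -> ~~ fat y -> P x -> ~~ P y -> #|Nf2 x y| = adj x y) ->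
  forall x, ~~ fat x -> P x.
Proof.
move=> Hind sx0 Px0 Porth x sx; apply/negPn/negP => nPx; apply: Hind.
exists (slim_closure P), (slim_closure (predC P)); split.
  by split; [exact: slim_closure_sub Px0 | exact: slim_closure_sub nPx |
             exact: slim_closureU].
split.
- rewrite -setI_eq0; apply/eqP/setP => v; rewrite !inE.
  by case: (fat v) => /=; rewrite ?andbF // !andbT andbN.
- have closed Q u v : u \in slim_closure Q -> ~~ fat u -> fat v -> adj u v ->
      v \in slim_closure Q.
    rewrite !inE => + su fv uv; rewrite (negbTE su) fv => Qu.
    by apply/existsP; exists u; rewrite su Qu adj_sym.
  by move=> W [->|->] u v; exact: closed.
- move=> u v; rewrite !inE => /andP[+ su] /andP[+ sv].
  rewrite (negbTE su) (negbTE sv) => Pu nPv.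
  by rewrite Porth //; case: (adj u v); split.
Qed.

(** Every fat vertex has a slim neighbor, which can only be [x]. *)
Lemma star_iso n (x : H) : ~~ fat x -> (forall y : H, ~~ fat y -> y = x) ->
  #|Nf x| = n -> hoffman_iso H (hoffman_star n).
Proof.
move=> sx onlyx cardN.
have xN y : y != x -> y \in Nf x.
  move=> yx; have fy : fat y by apply: contraNT yx => /onlyx->.
  have [z /andP[/onlyx-> yx']] := fat_has_slim fy.
  by rewrite inE fy adj_sym.
have Nx y : y \in Nf x -> y != x.
  by rewrite inE => /andP[fy _]; apply: contraNneq sx => <-.
have fatE y : fat y = (y != x).
  apply/idP/idP => [fy|/xN]; first by apply: contraNneq sx => <-.
  by rewrite inE => /andP[].
have ltN y : y != x -> (index y (enum (Nf x)) < n)%N.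
  by move=> /xN; rewrite -mem_enum -index_mem -cardE cardN.
(* The out-of-range value n sends [x] to [None], the slim vertex of the star. *)
pose f y : option 'I_n := insub (if y == x then n else index y (enum (Nf x))).
have fx : f x = None by rewrite /f eqxx insubN ?ltnn.
have fy y : y != x ->
    exists2 i : 'I_n, f y = Some i & val i = index y (enum (Nf x)).
  by move=> yx; rewrite /f (negbTE yx) insubT ?ltN // => lt; exists (Ordinal lt).
have fatf y : isSome (f y) = fat y.
  by rewrite fatE; case: eqVneq => [->|/fy[i ->]] //; rewrite fx.
exists f; split=> //.
- apply: inj_card_bij.
    move=> y z; have [->|yx] := eqVneq y x; have [->|zx] := eqVneq z x => //.
    + by rewrite fx; have [i ->] := fy z zx.
    + by rewrite fx; have [i ->] := fy y yx.
    have [i -> iy] := fy y yx; have [j -> jz] := fy z zx.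
    case=> ij; apply: (@index_inj _ x (enum (Nf x))); rewrite ?mem_enum ?xN //.
    by rewrite -iy ij jz.
  (* Injectivity suffices once the target, of size n + 1, is no larger than H: [Nf x] has n elements
     and misses [x]. *)
  rewrite card_option card_ord -cardN -cardsT; apply/proper_card/properP.
  by split; [exact: finset.subsetT | exists x; rewrite ?inE ?(negbTE sx)].
- move=> y z; rewrite /= /star_adj !fatf.
  case: (boolP (fat y)) (boolP (fat z)) => [yf|yf] [zf|zf] /=.
  + by rewrite (negbTE (fat_nadj yf zf)).
  + move: yf; rewrite fatE (onlyx z zf) => /xN.
    by rewrite adj_sym inE => /andP[_ ->].
  + move: zf; rewrite fatE (onlyx y yf) => /xN; by rewrite inE => /andP[_ ->].
  + by rewrite (onlyx y yf) (onlyx z zf) adj_irr.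
Qed.
End Combinatorics.

(** * Integer spans, and lattices generated by unit vectors *)

Section Subgroups.
Local Open Scope classical_set_scope.
Variables (R : realType) (n : nat).
Implicit Types (L S : set 'rV[R]_n) (u v w : 'rV[R]_n).

Lemma subgroupN L v : subgroup L -> L v -> L (- v).
Proof. by move=> [L0 LB] Lv; rewrite -sub0r; apply: LB. Qed.

Lemma subgroupD L u v : subgroup L -> L u -> L v -> L (u + v).
Proof.
by move=> sL Lu Lv; rewrite -[v]opprK; apply: sL.2 => //; exact: subgroupN.
Qed.

Lemma subgroupMz L v c : subgroup L -> L v -> L (v *~ c).
Proof.
move=> sL Lv; have Ln k : L (v *+ k).
  by elim: k => [|k IH]; [exact: sL.1 | rewrite mulrS; exact: subgroupD].
case: c => k; first exact: Ln.
by rewrite NegzE mulrNz; apply: subgroupN => //; exact: Ln.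
Qed.

Lemma zspan_subgroup S : subgroup (zspan S).
Proof.
split.
  by exists 0%N, (fun=> 0), (fun=> 0); split=> [[]|]//; rewrite big_ord0.
move=> _ _ [j [u [c [Su ->]]]] [k [v [d [Sv ->]]]].
exists (j + k)%N,
  (fun i : 'I_(j + k) =>
     match fintype.split i with inl a => u a | inr a => v a end),
  (fun i : 'I_(j + k) =>
     match fintype.split i with inl a => c a | inr a => - d a end); split.
  by move=> i; case: (fintype.split i).
rewrite big_split_ord -sumrN; congr (_ + _); apply: eq_bigr => i _.
  by rewrite (unsplitK (inl i)).
by rewrite (unsplitK (inr i)) mulrNz.
Qed.

Lemma sub_zspan S : S `<=` zspan S.
Proof.
by move=> v Sv; exists 1%N, (fun=> v), (fun=> 1); rewrite big_ord1 mulr1z.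
Qed.

Lemma zspan_min S L : subgroup L -> S `<=` L -> zspan S `<=` L.
Proof.
move=> sL SL _ [k [u [c [Su ->]]]]; apply: (big_ind L); first exact: sL.1.
  by move=> *; exact: subgroupD.
by move=> i _; apply: subgroupMz => //; apply: SL.
Qed.

Lemma zspan_sub S T : S `<=` zspan T -> zspan S `<=` zspan T.
Proof. by apply: zspan_min; exact: zspan_subgroup. Qed.

(** Serves to replace the set of all unit vectors of a lattice by a finite list. *)
Lemma zspan_fin_support S v : zspan S v ->
  exists2 s : seq 'rV[R]_n,
    (forall w, w \in s -> S w) & zspan [set w | w \in s] v.
Proof.
move=> [k [u [c [Su ->]]]]; exists [seq u i | i <- enum 'I_k].
  by move=> _ /mapP[i _ ->].
by exists k, u, c; split=> // i /=; rewrite map_f ?mem_enum.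
Qed.

(** The vectors whose product with [w] lies in the additive group [K] form a subgroup. It is applied
    with [K] zero and with [K] the integers. *)
Lemma zspan_dotp_ind (K : set R) S w :
  K 0 -> (forall a b, K a -> K b -> K (a - b)) ->
  (forall v, S v -> K (dotp v w)) -> forall v, zspan S v -> K (dotp v w).
Proof.
move=> K0 KB KS; apply: zspan_min => //; split=> [|u v Ku Kv] /=.
  by rewrite dotp0l.
by rewrite dotpBl; apply: KB.
Qed.

Lemma zspan_orthogonal S w : (forall v, S v -> dotp v w = 0) ->
  forall v, zspan S v -> dotp v w = 0.
Proof.
by apply: (zspan_dotp_ind (K := [set 0])) => // _ _ -> ->; exact: subrr.
Qed.

Lemma zspan_dotp_int S w : (forall v, S v -> dotp v w \is a Num.int) ->
  forall v, zspan S v -> dotp v w \is a Num.int.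
Proof.
apply: (zspan_dotp_ind (K := [set a | a \is a Num.int])); first exact: rpred0.
by move=> a b; exact: rpredB.
Qed.

Lemma zspan_integral S :
  (forall u v, S u -> S v -> dotp u v \is a Num.int) -> integral (zspan S).
Proof.
move=> SI u v zu zv; apply: zspan_dotp_int zu => w Sw.
by rewrite dotpC; apply: zspan_dotp_int zv => w' Sw'; exact: SI.
Qed.

Lemma integral_is_lattice L : subgroup L -> integral L -> is_lattice L.
Proof.
move=> sL LI; split=> //; exists 1 => // v Lv v0.
rewrite -(ger0_norm (dotp_ge0 v)); apply: norm_intr_ge1; first exact: LI.
by apply: contra_neq v0; exact: dotp_eq0.
Qed.

(** The isometry takes coordinates along the [e i]; it is faithful on the span because each vector
    there equals its orthonormal expansion. *)
Lemma orthonormal_isometric k (e : 'I_k -> 'rV[R]_n) :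
  (forall i j, dotp (e i) (e j) = (i == j)%:R) ->
  isometric (zspan (range e)) (standard_lattice R k).
Proof.
move=> eO; pose f v := \row_i dotp v (e i).
have fB u v : f (u - v) = f u - f v by apply/rowP => i; rewrite !mxE dotpBl.
have expand v : zspan (range e) v -> v = \sum_i f v 0 i *: e i.
  move: v; apply: (zspan_min (L := [set v | v = \sum_i f v 0 i *: e i]));
    last first.
    move=> _ [i _ <-]; rewrite /= (bigD1 i) //= mxE eO eqxx scale1r big1 ?addr0 //.
    by move=> j ji; rewrite mxE eO eq_sym (negbTE ji) scale0r.
  split=> [|u v /= uE vE].
    by rewrite /= big1 // => i _; rewrite mxE dotp0l scale0r.
  rewrite /= {1}uE {1}vE -sumrB; apply: eq_bigr => i _.
  by rewrite !mxE dotpBl scalerBl.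
exists f; split.
- split.
  + move=> v zv i; rewrite mxE; apply: zspan_dotp_int zv => _ [j _ <-].
    by rewrite eO natr_int.
  + by move=> u v; rewrite !inE => /expand {2}-> /expand {2}-> ->.
  (* The coordinates of [w] are integral, so [floor] only turns them into elements of [int]. *)
  + move=> w wI; exists (\sum_i e i *~ Num.floor (w 0 i)).
      exists k, e, (fun i => Num.floor (w 0 i)); split=> // i; exact: imageP.
    apply/rowP => j; rewrite mxE dotp_suml (bigD1 j) //= big1.
      by rewrite -scaler_int dotpZl eO eqxx mulr1 addr0 floorK //; exact: wI.
    by move=> i ij; rewrite -scaler_int dotpZl eO (negbTE ij) mulr0.
- by move=> u v _ _; apply/rowP => i; rewrite !mxE dotpDl.
- move=> u v /expand uE _; rewrite [in RHS]uE dotp_suml; apply: eq_bigr => i _.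
  by rewrite dotpZl [f v 0 i]mxE (dotpC v).
Qed.

(** A nonzero integer product has absolute value at least 1, which forces the squared length of u -
    v or of u + v, namely 2 - 2(u,v) or 2 + 2(u,v), to be at most 0. *)
Lemma unit_dotp_int u v : dotp u u = 1 -> dotp v v = 1 ->
  dotp u v \is a Num.int -> [\/ u = v, u = - v | dotp u v = 0].
Proof.
move=> u1 v1 uvI.
have [uv0|uv0] := eqVneq (dotp u v) 0; first by constructor 3.
have := norm_intr_ge1 uvI uv0; rewrite ler_normr => /orP[uv|uv].
  constructor 1; apply/subr0_eq/dotp_eq0/le_anti; rewrite dotp_ge0 andbT.
  by rewrite !dotpBl !dotpBr u1 v1 (dotpC v u); lra.
constructor 2; apply/eqP; rewrite -addr_eq0; apply/eqP/dotp_eq0/le_anti.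
by rewrite dotp_ge0 andbT !dotpDl !dotpDr u1 v1 (dotpC v u); lra.
Qed.

(** A vector is kept only when it is outside the span of those kept so far; it is then neither equal
    nor opposite to any of them, hence orthogonal to all. *)
Lemma orthonormal_sieve (s : seq 'rV[R]_n) :
  (forall v, v \in s -> dotp v v = 1) ->
  (forall u v, u \in s -> v \in s -> dotp u v \is a Num.int) ->
  exists t : seq 'rV[R]_n, [/\ uniq t, {subset t <= s},
    {in t &, forall u v, dotp u v = (u == v)%:R} &
    forall v, v \in s -> zspan [set w | w \in t] v].
Proof.
elim: s => [|x s IH] s1 sI; first by exists [::].
have [||t [tu ts tO tspan]] := IH.
- by move=> v vs; apply: s1; rewrite inE vs orbT.
- by move=> u v us vs; apply: sI; rewrite inE ?us ?vs orbT.
have x1 : dotp x x = 1 by apply: s1; rewrite mem_head.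
have [xt|xt] := pselect (zspan [set w | w \in t] x).
  exists t; split=> //; first by move=> v /ts vs; rewrite inE vs orbT.
  by move=> v; rewrite inE => /predU1P[->|/tspan].
have xO v : v \in t -> dotp x v = 0.
  move=> vt; have vs : v \in x :: s by rewrite inE ts ?orbT.
  have zv : zspan [set w | w \in t] v by exact: sub_zspan.
  have [xv|xv|//] := unit_dotp_int x1 (s1 v vs) (sI x v (mem_head _ _) vs).
    by rewrite xv in xt.
  by case: xt; rewrite xv; apply: subgroupN zv; exact: zspan_subgroup.
have xNt : x \notin t by apply: contra_notN xt => xt; exact: sub_zspan.
exists (x :: t); split.
- by rewrite /= xNt.
- by move=> v; rewrite !inE => /predU1P[->|/ts->]; rewrite ?eqxx ?orbT.
- have neq v : v \in t -> (x == v) = false.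
    by move=> vt; apply: contraNF xNt => /eqP->.
  move=> u v; rewrite !inE => /predU1P[->|ut] /predU1P[->|vt].
  + by rewrite x1 eqxx.
  + by rewrite xO // neq.
  + by rewrite dotpC xO // eq_sym neq.
  + exact: tO.
- move=> v; rewrite inE => /predU1P[->|vs].
    by apply: sub_zspan; rewrite /= mem_head.
  apply: zspan_sub (tspan v vs) => w /= wt; apply: sub_zspan.
  by rewrite /= inE wt orbT.
Qed.

Lemma zspan_unit_isometric (s : seq 'rV[R]_n) :
  (forall v, v \in s -> dotp v v = 1) ->
  (forall u v, u \in s -> v \in s -> dotp u v \is a Num.int) -> s != [::] ->
  exists2 k, (0 < k)%N &
    isometric (zspan [set w | w \in s]) (standard_lattice R k).
Proof.
move=> s1 sI s0; have [t [tu ts tO tspan]] := orthonormal_sieve s1 sI.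
pose e (i : 'I_(size t)) := t`_i.
have -> : zspan [set w | w \in s] = zspan (range e).
  have tE : range e = [set w | w \in t].
    apply/seteqP; split=> [_ [i _ <-]|w /= wt]; first exact: mem_nth.
    by exists (Ordinal (eqbRL (index_mem w t) wt)) => //; rewrite /e nth_index.
  rewrite tE; apply/seteqP; split; apply: zspan_sub => // w /= wt.
  by apply: sub_zspan; exact: ts.
exists (size t).
  (* An empty [t] would span only 0, yet its span contains the unit vectors of [s]. *)
  rewrite lt0n size_eq0; apply: contraNneq s0 => t0.
  case: s s1 tspan {sI ts} => // x s s1 /(_ x (mem_head _ _)) zx.
  have L0 : @subgroup R n [set 0] by split=> // _ _ -> ->; exact: subrr.
  rewrite t0 in zx; have x0 := zspan_min L0 _ zx; have := s1 x (mem_head _ _).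
  by rewrite x0 // dotp0l => /esym/eqP; rewrite oner_eq0.
apply: orthonormal_isometric => i j.
by rewrite tO ?mem_nth // nth_uniq.
Qed.
End Subgroups.

(** * The reduced lattice of an indecomposable Hoffman graph *)

Section ReducedLattice.
Local Open Scope classical_set_scope.
Variables (R : realType) (H : hoffman) (n : nat).
Variable psi : slim_vertex H -> 'rV[R]_n.
Hypothesis psi_repr : reduced_representation 3 psi.
Hypothesis H_indec : indecomposable H.

Lemma slim_connected (P : slim_vertex H -> Prop) x0 : P x0 ->
  (forall x y, P x -> ~ P y -> dotp (psi x) (psi y) = 0) -> forall x, P x.
Proof.
move=> Px0 Porth.
(* [Q] carries [P] over to a boolean predicate on all vertices. *)
pose Q (v : H) := [exists x : slim_vertex H, (val x == v) && `[< P x >]].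
have QE x : Q (val x) <-> P x.
  split=> [/existsP[y /andP[/eqP/val_inj-> /asboolP]] //|Px].
  by apply/existsP; exists x; rewrite eqxx; apply/asboolP.
suff QT v : ~~ fat v -> Q v by move=> x; apply/(QE x)/QT; exact: (valP x).
apply: (indecomposable_slim_pred H_indec (valP x0)); first exact/(QE x0).
suff Nf2E (x y : slim_vertex H) : Q (val x) -> ~~ Q (val y) ->
    #|Nf2 (val x) (val y)| = adj (val x) (val y).
  by move=> x y sx sy; exact: (Nf2E (exist _ x sx) (exist _ y sy)).
move=> /(QE x) Px /negP nQy; have {nQy}Py : ~ P y by move/(QE y).
(* For distinct slim vertices, orthogonality says that the number of common fat neighbors is 1 if
   they are adjacent and 0 if not. *)
have := Porth x y Px Py; rewrite psi_repr.
case: eqP => [xy|_]; first by rewrite xy in Px.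
case: adj => /eqP; last by rewrite oppr_eq0 pnatr_eq0 => /eqP.
by rewrite subr_eq0 eq_sym pnatr_eq1 => /eqP.
Qed.

Lemma psi_norm x : dotp (psi x) (psi x) = 3 - #|Nf (val x)|%:R.
Proof. by rewrite psi_repr eqxx. Qed.

Lemma psi_int x y : dotp (psi x) (psi y) \is a Num.int.
Proof.
rewrite psi_repr; do 2?case: ifP => _;
  by rewrite ?rpredB ?rpredN ?rpred1 ?natr_int.
Qed.

Lemma psi_span_integral : integral (zspan (range psi)).
Proof. by apply: zspan_integral => _ _ [x _ <-] [y _ <-]; exact: psi_int. Qed.

Lemma Lambda_red_standard :
  (forall x, dotp (psi x) (psi x) = 1 \/ dotp (psi x) (psi x) = 2) ->
  (exists x, dotp (psi x) (psi x) = 1) ->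
  exists2 k, (0 < k)%N & isometric (zspan (range psi)) (standard_lattice R k).
Proof.
move=> norm12 [x0 x01].
set L := zspan (range psi); have sL : subgroup L by exact: zspan_subgroup.
have Lpsi x : L (psi x) by apply: sub_zspan; exact: imageP.
pose U := [set v | L v /\ dotp v v = 1].
have UP x : zspan U (psi x).
  move: x; apply: (slim_connected (x0 := x0)); first by apply: sub_zspan.
  move=> x y zx zy; move: (psi x) zx; apply: zspan_orthogonal => v [Lv v1].
  have [y1|y2] := norm12 y; first by case: zy; exact: sub_zspan.
  (* Here psi(y) - w has squared length 3 - 2(w, psi(y)), at most 1; so it is 0 or a unit vector,
     and psi(y) would lie in the span of [U]. *)
  have step w : L w -> dotp w w = 1 -> ~ 1 <= dotp w (psi y).
    move=> Lw w1 wy; case: zy; rewrite -(subrK w (psi y)).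
    apply: subgroupD; [exact: zspan_subgroup | | exact: sub_zspan].
    have [->|yw0] := eqVneq (psi y - w) 0; first exact: (zspan_subgroup U).1.
    have Lyw : L (psi y - w) by exact: sL.2.
    apply: sub_zspan; split=> //; apply/le_anti/andP; split.
      by rewrite !dotpBl !dotpBr y2 w1 (dotpC (psi y)); lra.
    rewrite -(ger0_norm (dotp_ge0 _)); apply: norm_intr_ge1.
      exact: psi_span_integral.
    by apply: contra_neq yw0; exact: dotp_eq0.
  apply/eqP/negPn/negP => vy0.
  have := norm_intr_ge1 (psi_span_integral Lv (Lpsi y)) vy0.
  rewrite ler_normr => /orP[/step|vy]; first exact.
  (* If the product is at most -1, the unit vector -v is used instead. *)
  apply: (step (- v)); rewrite ?dotpNr ?(dotpC (- v)) ?dotpNr ?opprK //.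
    exact: subgroupN.
  by rewrite dotpC.
(* One finite list of unit vectors is chosen per slim vertex; their concatenation generates the
   lattice. *)
have [sq sqP] : {sq : slim_vertex H -> seq 'rV[R]_n & forall x,
    (forall w, w \in sq x -> U w) /\ zspan [set w | w \in sq x] (psi x)}.
  apply: (@boolp.choice _ _ (fun x s => (forall w, w \in s -> U w) /\
    zspan [set w | w \in s] (psi x))) => x.
  by have [s sU sx] := zspan_fin_support (UP x); exists s.
pose s := flatten [seq sq x | x <- enum (slim_vertex H)].
have sU w : w \in s -> U w.
  by move=> /flatten_mapP[x _]; exact: (sqP x).1.
have sqs x : zspan [set w | w \in s] (psi x).
  apply: zspan_sub (sqP x).2 => w /= ws; apply: sub_zspan.
  by apply/flatten_mapP; exists x; rewrite ?mem_enum.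
have -> : L = zspan [set w | w \in s].
  apply/seteqP; split; apply: zspan_min; rewrite -?/L //; try exact: zspan_subgroup.
    by move=> _ [x _ <-].
  by move=> w /sU[].
apply: zspan_unit_isometric => [v /sU[]//|u v /sU[Lu _] /sU[Lv _]|].
  exact: psi_span_integral.
apply: contraPneq (sqs x0) => ->; move/(zspan_min (L := [set 0])) => x00.
have := x01; rewrite x00 ?dotp0l // => [/esym/eqP|]; first by rewrite oner_eq0.
by split=> // _ _ -> ->; exact: subrr.
Qed.

Lemma Lambda_red_root : (forall x, dotp (psi x) (psi x) = 2) ->
  root_lattice (zspan (range psi)).
Proof.
move=> norm2; have sL := zspan_subgroup (range psi); split.
- by apply: integral_is_lattice => //; exact: psi_span_integral.
- exact: psi_span_integral.
- apply/seteqP; split; last by apply: zspan_min => // v [].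
  apply: zspan_sub => _ [x _ <-]; apply: sub_zspan; split=> //.
  by apply: sub_zspan; exact: imageP.
Qed.

Lemma zspan_norm_even : (forall x, dotp (psi x) (psi x) = 2) ->
  forall v, zspan (range psi) v -> dotp v v / 2 \is a Num.int.
Proof.
move=> norm2 v zv.
(* Membership in the lattice is carried along so that the cross term (u,v) is integral when the
   subgroup is closed under subtraction. *)
suff [] : (zspan (range psi) `&` [set w | dotp w w / 2 \is a Num.int]) v by [].
move: v zv; apply: zspan_min; last first.
  move=> _ [x _ <-]; split; first by apply: sub_zspan; exact: imageP.
  by rewrite /= norm2 divff ?pnatr_eq0.
have sL := zspan_subgroup (range psi).
split; first by split; [exact: sL.1 | rewrite /= dotp0l mul0r rpred0].
move=> u v [Lu uE] [Lv vE]; split; first exact: sL.2.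
rewrite /= in uE vE *.
have -> : dotp (u - v) (u - v) / 2 = dotp u u / 2 + dotp v v / 2 - dotp u v.
  by rewrite !dotpBl !dotpBr (dotpC v u); field.
by rewrite rpredB ?rpredD //; exact: psi_span_integral.
Qed.

Lemma Lambda_red_irreducible : (0 < #|slim_vertex H|)%N ->
  (forall x, dotp (psi x) (psi x) = 2) ->
  irreducible (zspan (range psi)).
Proof.
move=> /card_gt0P[x0 _] norm2 [L1 [L2 [[s1 _] [s2 _] L10 L20 [O12 I12 LE]]]].
have sub1 : L1 `<=` zspan (range psi).
  by move=> v L1v; rewrite LE; exists v, 0; rewrite addr0; split=> //; exact: s2.1.
have sub2 : L2 `<=` zspan (range psi).
  by move=> v L2v; rewrite LE; exists 0, v; rewrite add0r; split=> //; exact: s1.1.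
have psi12 x : L1 (psi x) \/ L2 (psi x).
  have : zspan (range psi) (psi x) by apply: sub_zspan; exact: imageP.
  rewrite LE => -[u [v [L1u L2v xE]]]; rewrite xE.
  have [->|u0] := eqVneq u 0; first by right; rewrite add0r.
  have [->|v0] := eqVneq v 0; first by left; rewrite addr0.
  (* By evenness, two nonzero orthogonal components would each have squared length at least 2, while
     psi(x) has squared length 2 in all. *)
  have half_ge1 w : zspan (range psi) w -> w != 0 -> 1 <= dotp w w / 2.
    move=> Lw w0; have := norm_intr_ge1 (zspan_norm_even norm2 Lw).
    rewrite ger0_norm ?divr_ge0 ?dotp_ge0 //; apply.
    rewrite mulf_neq0 ?invr_eq0 ?pnatr_eq0 //.
    by apply: contra_neq w0; exact: dotp_eq0.
  have := half_ge1 u (sub1 u L1u) u0; have := half_ge1 v (sub2 v L2v) v0.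
  have := norm2 x; rewrite xE dotpDl !dotpDr (dotpC v) (O12 u v) //; lra.
(* A summand containing every psi(x) is the whole lattice, so it contains the other summand, which
   it meets only in 0. *)
have summand_neq0 (A B : set 'rV[R]_n) : subgroup A -> subgroup B ->
    B `<=` zspan (range psi) -> A `&` B = [set 0] -> B <> [set 0] ->
    ~ forall x, A (psi x).
  move=> sA sB BL AB B0 Apsi; apply: B0; rewrite -AB setIC; apply/esym/setIidl.
  by move=> v /BL; move: v; apply: zspan_min => // _ [x _ <-].
have [[x1 x1L]|/forallNP no1] := pselect (exists x, L1 (psi x)); last first.
  apply: (summand_neq0 L2 L1) => // [|x]; first by rewrite setIC.
  by case: (psi12 x) => // /no1.
apply: (summand_neq0 L1 L2) => //.
apply: (slim_connected (x0 := x1)) => // x y Lx Ly.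
by apply: O12 => //; case: (psi12 y).
Qed.
End ReducedLattice.

Theorem theorem3p7 (R : realType) (H : hoffman)
    (H_fat : fat_hoffman H) (H_indec : indecomposable H)
    (H_min : - 3 <= lambda_min R H) :
  (forall x : H, ~~ fat x -> (#|Nf x| <= 3)%N) /\
  [/\ (exists2 x : H, ~~ fat x & #|Nf x| = 3%N) ->
        hoffman_iso H (hoffman_star 3),
      (forall x : H, ~~ fat x -> #|Nf x| <> 3%N) ->
      (exists2 x : H, ~~ fat x & #|Nf x| = 2%N) ->
        Lambda_red_has H (3 : R) (fun d L =>
          exists2 n : nat, (0 < n)%N & isometric L (standard_lattice R n)) &
      (forall x : H, ~~ fat x -> #|Nf x| = 1%N) ->
        Lambda_red_has H (3 : R) (fun d L => root_lattice L /\ irreducible L)].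
Proof.
have ex_repr := reduced_representation_ex H_min.
have [n [psi psiP]] := ex_repr.
have le3 (x : H) : ~~ fat x -> (#|Nf x| <= 3)%N.
  move=> sx; have := dotp_ge0 (psi (exist _ x sx)).
  by rewrite (psi_norm psiP) subr_ge0 ler_nat.
have gt0 (x : H) : ~~ fat x -> (0 < #|Nf x|)%N.
  by move=> /H_fat[y xy]; apply/card_gt0P; exists y; rewrite inE.
split=> //; split.
- move=> [x sx N3]; apply: (star_iso sx _ N3) => y sy.
  pose x' : slim_vertex H := exist _ x sx; pose y' : slim_vertex H := exist _ y sy.
  suff /(congr1 val) : y' = x' by [].
  have psix0 : psi x' = 0 by apply: dotp_eq0; rewrite (psi_norm psiP) /= N3 subrr.
  (* The property propagated is that of being [x'] itself. *)
  apply: (slim_connected psiP H_indec (P := fun z => z = x') (x0 := x')) => //.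
  by move=> _ z -> _; rewrite psix0 dotp0l.
- move=> neq3 [x sx N2]; split=> // d phi phiP.
  apply: (Lambda_red_standard phiP H_indec).
    move=> y; rewrite (psi_norm phiP).
    (* Only one or two fat neighbors remain possible, giving squared length 2 or 1. *)
    have := neq3 _ (valP y); have := le3 _ (valP y); have := gt0 _ (valP y).
    by case: #|_| => [|[|[|[]]]] // _ _ _; [right|left]; rewrite -natrB.
  by exists (exist _ x sx); rewrite (psi_norm phiP) /= N2 -natrB.
- move=> eq1; split=> // d phi phiP.
  have norm2 y : dotp (phi y) (phi y) = 2.
    by rewrite (psi_norm phiP) eq1 ?(valP y) //; lra.
  split; first exact: Lambda_red_root.
  apply: Lambda_red_irreducible => //.
  have /card_gt0P[v _] := vertex_neq0 H.
  have [x sx] : exists x : H, ~~ fat x.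
    case: (boolP (fat v)) => [/fat_has_slim[x /andP[sx _]]|sv]; first by exists x.
    by exists v.
  by apply/card_gt0P; exists (exist _ x sx).
Qed.
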